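(* Let $\alpha$, $\beta$, $\sigma$ be nonempty consecutive patterns. If $\alpha$ and $\beta$ are Wilf-equivalent, then $\alpha\oplus\sigma$ and $\beta\oplus\sigma$ are filling-shape-Wilf-equivalent.
   Context: A vincular pattern of length $k$ is a pair $(\sigma,X)$ with $\sigma\in S_k$ and $X\subseteq[k-1]$. It is consecutive if $X=[k-1]$. Direct sum: $(\sigma,A)\oplus(\tau,B)=(\sigma_1\cdots\sigma_k(\tau_1+k)\cdots(\tau_\ell+k),\ A\cup\{i+k:i\in B\})$, where $k$ is the length of $\sigma$ and $\ell$ that of $\tau$. Thus $\alpha\oplus\sigma$ has a single dash, between its $\alpha$-part and its $\sigma$-part. A permutation $\pi\in S_n$ contains $(\sigma,X)$ if there are $i_1<\dots<i_k$ with $\pi_{i_1}\cdots\pi_{i_k}$ order-isomorphic to $\sigma$ and $i_{j+1}=i_j+1$ for all $j\in X$. Two patterns are Wilf-equivalent if, for every $n$, equally many permutations of $S_n$ avoid each. A Young board $\lambda=(\lambda_1,\dots,\lambda_n)$ with $\lambda_1\ge\dots\ge\lambda_n>0$ is the cell set $\{(i,j):1\le i\le n,\ 1\le j\le\lambda_i\}$, with width $n$ and height $\lambda_1$. A filling is a $0/1$ assignment to the cells with at most one $1$ per row and per column. It is encoded by the word $\pi_1\cdots\pi_n$ with $\pi_c=r$ if $(c,r)$ holds a $1$ and $\pi_c=\square$ if column $c$ is empty. A filling $\pi$ contains $(\sigma,X)$ if there are $i_1<\dots<i_k$ such that all of the following hold: - all $\pi_{i_j}$ are numbers; - $\pi_{i_1}\cdots\pi_{i_k}$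 is order-isomorphic to $\sigma$; - $i_{j+1}=i_j+1$ for $j\in X$; - the cell $(i_k,\max_j\pi_{i_j})$ lies in $\lambda$. Otherwise $\pi$ avoids $(\sigma,X)$. $\mathcal{S}_\lambda^{C,R}(\sigma)$ denotes the set of fillings of $\lambda$ with empty columns exactly $C$ and empty rows exactly $R$ that avoid $\sigma$. Patterns $\sigma,\tau$ are filling-shape-Wilf-equivalent if $|\mathcal{S}_\lambda^{C,R}(\sigma)|=|\mathcal{S}_\lambda^{C,R}(\tau)|$ for all Young boards $\lambda$ and all $C\subseteq[\text{width}(\lambda)]$, $R\subseteq[\text{height}(\lambda)]$. *)

(* Defs.v *)
From mathcomp Require Import all_boot all_fingroup.

Set Implicit Arguments.
Unset Strict Implicit.
Unset Printing Implicit Defensive.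

(* Positions, values, columns and rows are numbered from 0. *)

(* An element j of [vadj p] says that positions j and j.+1 must be adjacent. *)
Record vpattern (k : nat) := VPattern {
  vperm : 'S_k;
  vadj : {set 'I_k.-1}
}.

Definition consecutive k (p : vpattern k) : Prop := vadj p = [set: 'I_k.-1].

Definition dsum_fun k l (s : 'S_k) (t : 'S_l) (i : 'I_(k + l)) : 'I_(k + l) :=
  match split i with
  | inl a => lshift l (s a)
  | inr b => rshift k (t b)
  end.

Lemma dsum_fun_inj k l (s : 'S_k) (t : 'S_l) : injective (dsum_fun s t).
Proof.
move=> x y; rewrite /dsum_fun.
case: (split_ordP x) => a ->; case: (split_ordP y) => b -> /eqP;
  rewrite ?eq_lshift ?eq_rshift ?eq_lrshift ?eq_rlshift // => /eqP.
- by move/perm_inj=> ->.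
- by move/perm_inj=> ->.
Qed.

Definition dsum k l (p : vpattern k) (q : vpattern l) : vpattern (k + l) :=
  VPattern (perm (@dsum_fun_inj k l (vperm p) (vperm q)))
    [set j : 'I_(k + l).-1 | [exists i in vadj p, j == i :> nat]
                          || [exists i in vadj q, j == i + k :> nat]].

Definition vpositions k (X : {set 'I_k.-1}) n (f : 'I_k -> 'I_n) : bool :=
  [forall a : 'I_k, forall b : 'I_k, (a < b) ==> (f a < f b)] &&
  [forall j in X, forall a : 'I_k, forall b : 'I_k,
     (a == j :> nat) && (b == j.+1 :> nat) ==> (f b == (f a).+1 :> nat)].

Definition order_iso k m n (u : 'I_k -> 'I_m) (v : 'I_k -> 'I_n) : bool :=
  [forall a : 'I_k, forall b : 'I_k, (u a < u b) == (v a < v b)].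

Definition perm_contains n (pi : 'S_n) k (p : vpattern k) : bool :=
  [exists f : {ffun 'I_k -> 'I_n},
     vpositions (vadj p) f && order_iso (fun a => pi (f a)) (vperm p)].

Definition Wilf_equiv k l (p : vpattern k) (q : vpattern l) : Prop :=
  forall n : nat,
    #|[set pi : 'S_n | ~~ perm_contains pi p]| =
    #|[set pi : 'S_n | ~~ perm_contains pi q]|.

(* A Young board is the sequence of its column heights, from left to right. *)
Definition young_board (lam : seq nat) : bool :=
  sorted geq lam && all (fun x => 0 < x) lam.

Definition width (lam : seq nat) : nat := size lam.

Definition height (lam : seq nat) : nat := head 0 lam.

Definition in_board (lam : seq nat) (c r : nat) : bool := r < nth 0 lam c.

(* A 0/1 assignment is represented by the set of the cells (column, row)
   holding a 1. *)
Definition is_filling lam (A : {set 'I_(width lam) * 'I_(height lam)}) : bool :=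
  [&& [forall x in A, in_board lam x.1 x.2],
      [forall c, #|[set r | (c, r) \in A]| <= 1]
    & [forall r, #|[set c | (c, r) \in A]| <= 1]].

(* The empty-column symbol is None. *)
Definition filling_word lam (A : {set 'I_(width lam) * 'I_(height lam)})
    (c : 'I_(width lam)) : option 'I_(height lam) :=
  [pick r | (c, r) \in A].

(* In the last conjunct [a] is the last position of the pattern. *)
Definition filling_contains lam (A : {set 'I_(width lam) * 'I_(height lam)})
    k (p : vpattern k) : bool :=
  [exists f : {ffun 'I_k -> 'I_(width lam)},
   exists g : {ffun 'I_k -> 'I_(height lam)},
   [&& [forall a, filling_word A (f a) == Some (g a)],
       order_iso g (vperm p),
       vpositions (vadj p) f
     & [forall a : 'I_k, (a.+1 == k) ==> in_board lam (f a) (\max_b g b)]]].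

Definition empty_columns lam (A : {set 'I_(width lam) * 'I_(height lam)}) :=
  [set c : 'I_(width lam) | [forall r, (c, r) \notin A]].

Definition empty_rows lam (A : {set 'I_(width lam) * 'I_(height lam)}) :=
  [set r : 'I_(height lam) | [forall c, (c, r) \notin A]].

Definition avoiding_fillings lam (C : {set 'I_(width lam)})
    (R : {set 'I_(height lam)}) k (p : vpattern k) :=
  [set A : {set 'I_(width lam) * 'I_(height lam)} |
     [&& is_filling A, empty_columns A == C, empty_rows A == R
       & ~~ filling_contains A p]].

Definition filling_shape_Wilf_equiv k l (p : vpattern k) (q : vpattern l)
    : Prop :=
  forall lam : seq nat, young_board lam ->
  forall (C : {set 'I_(width lam)}) (R : {set 'I_(height lam)}),
    #|avoiding_fillings C R p| = #|avoiding_fillings C R q|.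

(* Main.v *)
Require Import Defs.
From mathcomp Require Import all_boot all_fingroup zify.

(* Call a nonempty column inner if to its right there is an occurrence of sigma,
   with larger values, that fits in the board.  Goodness (the existence of such
   an occurrence above a given row) does not change along a run of consecutive
   inner columns, so alpha (+) sigma occurs iff alpha occurs within a maximal run
   of inner columns.  The rightmost occurrence of sigma that witnesses goodness
   contains no inner column, so rearranging the entries inside every run changes
   neither goodness nor the set of inner columns.  Rearranging each run by an
   injection, induced by the Wilf equivalence, from alpha-avoiding to
   beta-avoiding sequences on the same values gives an injection from the
   fillings avoiding alpha (+) sigma to those avoiding beta (+) sigma with the
   same empty rows and columns; exchange alpha and beta for the converse. *)

Set Implicit Arguments.
Unset Strict Implicit.
Unset Printing Implicit Defensive.

(** * Occurrences on intervals of positions, and adjacency in direct sums *)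

Definition occ k (t : 'S_k) (w : nat -> nat) (d : nat) : bool :=
  [forall i : 'I_k, forall j : 'I_k, (w (d + i) < w (d + j)) == (t i < t j)].

Lemma occP k (t : 'S_k) w d :
  reflect (forall i j : 'I_k, (w (d + i) < w (d + j)) = (t i < t j)) (occ t w d).
Proof.
apply: (iffP forallP) => [h i j|h i].
  by have /forallP/(_ j)/eqP := h i.
by apply/forallP => j; rewrite h.
Qed.

Lemma eq_occ k (t : 'S_k) w w' d d' :
  (forall i : 'I_k, w (d + i) = w' (d' + i)) -> occ t w d = occ t w' d'.
Proof.
by move=> e; apply/occP/occP => h i j; [rewrite -!e | rewrite !e]; apply: h.
Qed.

Lemma vpositions_consecutive k n (f : 'I_k -> 'I_n) : 0 < k ->
  vpositions [set: 'I_k.-1] f <-> exists d, forall i, f i = d + i :> nat.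
Proof.
case: k f => // k f _; split.
  case/andP => _ /'forall_implyP h; exists (f ord0) => -[i hi].
  elim: i hi => [|i IH] hi /=; first by rewrite addn0; congr (_ (f _)); apply: val_inj.
  have hi' : i < k.+1 by lia.
  have hik : i < k by lia.
  have /forallP/(_ (Ordinal hi'))/forallP/(_ (Ordinal hi)) := h (Ordinal hik) (in_setT _).
  by rewrite !eqxx /= => /eqP ->; rewrite IH /= addnS.
case=> d e; apply/andP; split.
  by apply/'forall_forallP => i j; apply/implyP; rewrite !e; lia.
apply/'forall_implyP => j _; apply/'forall_forallP => x y; rewrite !e.
by apply/implyP => /andP[/eqP -> /eqP ->]; rewrite addnS.
Qed.

(** The direct sum imposes every adjacency inside each block and none across the dash, so the
    positions form two disjoint intervals, the first to the left of the second. *)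
Lemma vpositions_dsum k l (p : vpattern k) (q : vpattern l) n
    (f : 'I_(k + l) -> 'I_n) :
  0 < k -> 0 < l -> consecutive p -> consecutive q ->
  vpositions (vadj (dsum p q)) f <->
  exists c d, [/\ c + k <= d, forall i, f (lshift l i) = c + i :> nat
                & forall j, f (rshift k j) = d + j :> nat].
Proof.
move=> k0 l0 cp cq; split.
  case/andP => /'forall_forallP mf /'forall_implyP h.
  have [c hc] : exists c, forall i, f (lshift l i) = c + i :> nat.
    apply/(vpositions_consecutive (fun i => f (lshift l i))) => //.
    apply/andP; split; first by apply/'forall_forallP => i j; apply: mf.
    apply/'forall_implyP => j _; apply/'forall_forallP => x y.
    have hj : j < (k + l).-1 by have := ltn_ord j; lia.
    have hjin : Ordinal hj \in vadj (dsum p q).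
      rewrite inE; apply/orP; left; apply/existsP; exists j.
      by rewrite cp inE eqxx.
    by have /'forall_forallP/(_ (lshift l x) (lshift l y)) := h _ hjin.
  have [d hd] : exists d, forall j, f (rshift k j) = d + j :> nat.
    apply/(vpositions_consecutive (fun i => f (rshift k i))) => //.
    apply/andP; split.
      apply/'forall_forallP => i j; apply/implyP => ij.
      by apply: (implyP (mf _ _)); rewrite /= ltn_add2l.
    apply/'forall_implyP => j _; apply/'forall_forallP => x y.
    have hj : j + k < (k + l).-1 by have := ltn_ord j; lia.
    have hjin : Ordinal hj \in vadj (dsum p q).
      rewrite inE; apply/orP; right; apply/existsP; exists j.
      by rewrite cq inE eqxx.
    have /'forall_forallP/(_ (rshift k x) (rshift k y)) := h _ hjin.
    by rewrite /= addnC eqn_add2r addnC -addSn eqn_add2r.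
  exists c, d; split=> //.
  (* Monotonicity across the dash, from the last position of the first block to the first of the
     second, gives [c + k <= d]. *)
  have kk : k.-1 < k by lia.
  have := mf (lshift l (Ordinal kk)) (rshift k (Ordinal l0)).
  rewrite hc hd /=; lia.
case=> c [d [cd hc hd]]; apply/andP; split.
  apply/'forall_forallP => x y; apply/implyP.
  case: (split_ordP x) => i ->; case: (split_ordP y) => j ->;
    rewrite ?hc ?hd /=; have := ltn_ord i; have := ltn_ord j; lia.
apply/'forall_implyP => j; rewrite inE => hj; apply/'forall_forallP => x y.
apply/implyP => /andP[/eqP ex /eqP ey]; apply/eqP.
case/orP: hj => /existsP[i /andP[_ /eqP ej]]; have := ltn_ord i;
case: (split_ordP x) ex => x' -> /=; case: (split_ordP y) ey => y' -> /=;
 rewrite ?hc ?hd /=; have := ltn_ord x'; have := ltn_ord y'; lia.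
Qed.

(** * Rearranging a sequence through a Wilf equivalence *)

Definition transfer (T : finType) (A B : {set T}) (x : T) : T :=
  nth x (enum B) (index x (enum A)).

Lemma transfer_in (T : finType) (A B : {set T}) x :
  #|A| = #|B| -> x \in A -> transfer A B x \in B.
Proof.
move=> e xA; rewrite /transfer -(mem_enum B) mem_nth // -cardE -e cardE.
by rewrite index_mem mem_enum.
Qed.

Lemma transfer_inj (T : finType) (A B : {set T}) :
  #|A| = #|B| -> {in A &, injective (transfer A B)}.
Proof.
move=> e x y xA yA; have h z : z \in A -> index z (enum A) < size (enum B).
  by move=> zA; rewrite -cardE -e cardE index_mem mem_enum.
(* The default value in [transfer] is its own argument; both sides need the same one before
   [nth_uniq] applies. *)
rewrite /transfer (set_nth_default y x) ?h // => /eqP.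
rewrite nth_uniq ?enum_uniq ?h // => /eqP exy.
by rewrite -(nth_index x (s := enum A) (x := x)) ?mem_enum // exy nth_index ?mem_enum.
Qed.

(** For strictly increasing [y] of length [n], this is the arrangement of the values of [y] that is
    order-isomorphic to [p]. *)
Definition decode n (y : seq nat) (p : 'S_n) : seq nat :=
  [seq nth 0 y (p i) | i <- enum 'I_n].

Lemma size_decode n y (p : 'S_n) : size (decode y p) = n.
Proof. by rewrite size_map size_enum_ord. Qed.

Lemma nth_decode n y (p : 'S_n) (i : 'I_n) :
  nth 0 (decode y p) i = nth 0 y (p i).
Proof. by rewrite (nth_map i) ?size_enum_ord // nth_ord_enum. Qed.

Lemma decode_tuple n (y : n.-tuple nat) (p : 'S_n) :
  decode y p = [tuple tnth y (p i) | i < n].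
Proof.
rewrite /= /decode.
by apply: eq_map => i /=; rewrite (tnth_nth 0).
Qed.

Lemma perm_decode n y (p : 'S_n) : size y = n -> perm_eq (decode y p) y.
Proof.
move=> sy; have ty : size y == n by rewrite sy.
by apply/(@tuple_permP _ _ _ (Tuple ty)); exists p; rewrite -decode_tuple.
Qed.

Lemma decode_inj n y : uniq y -> size y = n -> injective (@decode n y).
Proof.
move=> uy sy p q e; apply/permP => i.
have : nth 0 (decode y p) i = nth 0 (decode y q) i by rewrite e.
by rewrite !nth_decode => /eqP; rewrite nth_uniq ?sy // => /eqP/val_inj.
Qed.

(** On a sequence of length [n] the search succeeds, since [x] is a rearrangement of its sorted
    form; the default [1] only makes the function total. *)
Definition standardization n (x : seq nat) : 'S_n :=
  odflt 1%g [pick p : 'S_n | decode (sort leq x) p == x].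

Lemma standardizationK n x :
  size x = n -> decode (sort leq x) (standardization n x) = x.
Proof.
move=> sx; rewrite /standardization; case: pickP => [p /eqP //|h].
have ty : size (sort leq x) == n by rewrite size_sort sx.
have: perm_eq x (Tuple ty) by rewrite /= perm_sym perm_sort.
case/tuple_permP => p; rewrite -decode_tuple /= => e.
by have := h p; rewrite -e eqxx.
Qed.

Definition seq_contains k (t : 'S_k) (x : seq nat) : Prop :=
  exists2 d, d + k <= size x & occ t (nth 0 x) d.

Lemma nth_sorted_ltn y i j :
  sorted ltn y -> i < size y -> j < size y -> (nth 0 y i < nth 0 y j) = (i < j).
Proof.
move=> sy hi hj.
have h i' j' : i' < size y -> j' < size y -> i' < j' -> nth 0 y i' < nth 0 y j'.
  by move=> hi' hj' ij; apply: (sorted_ltn_nth ltn_trans) => //.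
case: (ltngtP i j) => [ij|ji|->]; last by rewrite ltnn.
  by rewrite h.
by apply/negbTE; rewrite -leqNgt ltnW // h.
Qed.

(** Indexing a strictly increasing sequence preserves and reflects order, so a consecutive pattern
    occurs at the same places in [pi] and in its decoding. *)
Lemma seq_contains_decode n y (pi : 'S_n) k (p : vpattern k) :
  sorted ltn y -> size y = n -> 0 < k -> consecutive p ->
  seq_contains (vperm p) (decode y pi) <-> perm_contains pi p.
Proof.
move=> sy zy k0 cp; rewrite /perm_contains cp; split.
  case=> d; rewrite size_decode => dk /occP h.
  have hf (i : 'I_k) : d + i < n by have := ltn_ord i; lia.
  apply/existsP; exists [ffun i => Ordinal (hf i)]; apply/andP; split.
    by apply/vpositions_consecutive => //; exists d => i; rewrite ffunE.
  apply/'forall_forallP => i j; rewrite !ffunE -h.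
  by rewrite (nth_decode y pi (Ordinal (hf i))) (nth_decode y pi (Ordinal (hf j)))
       nth_sorted_ltn ?zy.
case/existsP => f /andP[/(vpositions_consecutive _ k0)[d hd] /'forall_forallP h].
exists d.
  have kk : k.-1 < k by lia.
  have := ltn_ord (f (Ordinal kk)); rewrite size_decode (hd (Ordinal kk)) /=; lia.
apply/occP => i j; rewrite -!hd !nth_decode nth_sorted_ltn ?zy //.
exact: (eqP (h i j)).
Qed.

Definition avoiders k (p : vpattern k) n : {set 'S_n} :=
  [set pi : 'S_n | ~~ perm_contains pi p].

(** The values of [x] are kept and only their order pattern is changed. The result is a
    rearrangement of [x] even when [x] contains [p]. *)
Definition rearrange k l (p : vpattern k) (q : vpattern l) (x : seq nat) :=
  let n := size x in
  decode (sort leq x)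
    (transfer (avoiders p n) (avoiders q n) (standardization n x)).

Lemma perm_rearrange k l (p : vpattern k) (q : vpattern l) x :
  perm_eq (rearrange p q x) x.
Proof.
by rewrite (perm_trans (perm_decode _ (size_sort _ _))) // perm_sort.
Qed.

Lemma sorted_ltn_sort x : uniq x -> sorted ltn (sort leq x).
Proof.
move=> ux; rewrite ltn_sorted_uniq_leq sort_uniq ux.
by apply: sort_sorted; exact: leq_total.
Qed.

Lemma standardization_avoider k (p : vpattern k) x :
  0 < k -> consecutive p -> uniq x -> ~ seq_contains (vperm p) x ->
  standardization (size x) x \in avoiders p (size x).
Proof.
move=> k0 cp ux hx; rewrite inE; apply/negP.
move/(seq_contains_decode _ (sorted_ltn_sort ux) (size_sort _ _) k0 cp).
by rewrite standardizationK.
Qed.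

Section Rearrange.
Variables (k l : nat) (p : vpattern k) (q : vpattern l).
Hypotheses (k0 : 0 < k) (l0 : 0 < l) (cp : consecutive p) (cq : consecutive q).
Hypothesis pq : Wilf_equiv p q.

Lemma rearrange_avoids x : uniq x -> ~ seq_contains (vperm p) x ->
  ~ seq_contains (vperm q) (rearrange p q x).
Proof.
move=> ux hx.
move/(seq_contains_decode _ (sorted_ltn_sort ux) (size_sort _ _) l0 cq).
apply/negP; have := transfer_in (pq _) (standardization_avoider k0 cp ux hx).
by rewrite inE.
Qed.

(** Equal images have the same values, hence equal sorted forms; [decode], [transfer] on avoiders
    and standardization are then undone in turn. *)
Lemma rearrange_inj x y : uniq x -> uniq y ->
  ~ seq_contains (vperm p) x -> ~ seq_contains (vperm p) y ->
  rearrange p q x = rearrange p q y -> x = y.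
Proof.
move=> ux uy hx hy e.
have exy : perm_eq x y.
  by rewrite -(permPl (perm_rearrange p q x)) e perm_rearrange.
have exys : sort leq x = sort leq y.
  by apply/perm_sortP => //; [exact: leq_total|exact: leq_trans|exact: anti_leq].
have sxy := perm_size exy.
have ax := standardization_avoider k0 cp ux hx.
have ay := standardization_avoider k0 cp uy hy.
move: e ax; rewrite /rearrange exys sxy => /decode_inj.
rewrite sort_uniq size_sort => /(_ uy erefl) e ax.
have es := transfer_inj (pq _) ax ay e.
by have := standardizationK sxy; rewrite es exys standardizationK.
Qed.

End Rearrange.

(** * Inner columns, and their invariance under rearrangement *)

Section Inner.
Variables (lam : seq nat) (s : nat) (t : 'S_s).
Hypothesis s0 : 0 < s.

(* A word codes the empty column by 0 and a 1 in row [r] by [r.+1]; [r] below is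
   likewise a coded row. *)
Definition good (w : nat -> nat) (c r : nat) : bool :=
  [exists d : 'I_(size lam), [&& c < d, occ t w d
     & [forall j : 'I_s, r < w (d + j) <= nth 0 lam (d + s.-1)]]].

Lemma goodP w c r :
  reflect (exists d, [/\ c < d, occ t w d
             & forall j : 'I_s, r < w (d + j) <= nth 0 lam (d + s.-1)])
          (good w c r).
Proof.
apply: (iffP existsP) => [[d /and3P[cd ho /forallP h]]|[d [cd ho h]]].
  by exists (val d).
(* Beyond the board the default height 0 would force [r < w (d + j) <= 0]. *)
have hd : d < size lam.
  rewrite ltnNge; apply/negP => hd; have := h (Ordinal s0).
  by rewrite [nth 0 lam _]nth_default; lia.
by exists (Ordinal hd); rewrite /= cd ho; apply/forallP.
Qed.

Definition inner w c : bool := (0 < w c) && good w c (w c).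

Lemma inner_lt_size w c : inner w c -> c < size lam.
Proof.
case/andP => _ /existsP[d /and3P[cd _ _]].
exact: ltn_trans cd (ltn_ord d).
Qed.

Lemma good_anti w c c' r r' : c' <= c -> r' <= r -> good w c r -> good w c' r'.
Proof.
move=> hc hr /goodP[d [cd ho h]]; apply/goodP; exists d; split=> //; first lia.
by move=> j; have := h j; lia.
Qed.

(* If the only witness of [good w c r] starts at [c.+1], then [r < w c.+1], so
   a witness that [c.+1] is inner also lies above [r]. *)
Lemma good_step w c r : inner w c.+1 -> good w c r -> good w c.+1 r.
Proof.
move=> /andP[_ hi] /goodP[d [cd ho h]].
case: (ltngtP c.+1 d) => [cd'||ecd]; [|lia|].
  by apply/goodP; exists d.
apply: good_anti hi => //; have := h (Ordinal s0).
by rewrite addn0 -ecd; lia.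
Qed.

Lemma good_run w c c' r : c <= c' ->
  (forall x, c < x <= c' -> inner w x) -> good w c r -> good w c' r.
Proof.
elim: c' => [|c' IH] hc hi h; first by move: h; rewrite (_ : c = 0) //; lia.
move: hc; rewrite leq_eqVlt => /predU1P[<- //|hc].
apply: good_step; first by apply: hi; lia.
by apply: IH => // x hx; apply: hi; lia.
Qed.

(** Containment of the sum of [p] and [t] with one dash. The maximum lies in the [t]-block, whose
    last column is [d + s.-1]; as rows are coded with a shift by one, fitting in the board reads
    [<=]. *)
Definition word_contains k (p : 'S_k) w : Prop :=
  exists c d, [/\ c + k <= d, occ p w c, occ t w d,
    forall (i : 'I_k) (j : 'I_s), 0 < w (c + i) < w (d + j)
    & forall j : 'I_s, w (d + j) <= nth 0 lam (d + s.-1)].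

Lemma word_containsP k (p : 'S_k) w : 0 < k ->
  word_contains p w <->
  exists2 c, occ p w c & forall i : 'I_k, inner w (c + i).
Proof.
move=> k0; split.
  case=> c [d [cd hp ht h hb]]; exists c => // i; apply/andP; split.
    by have /andP[] := h i (Ordinal s0).
  apply/goodP; exists d; split=> //; first by have := ltn_ord i; lia.
  by move=> j; rewrite hb andbT; have /andP[] := h i j.
case=> c hp hi.
(* Goodness above the largest entry of the block, carried along the inner columns to the last
   position of the block, gives one witness to the right of and above all of it. *)
case: (@arg_maxnP 'I_k (Ordinal k0) predT (fun i => w (c + i))) => // m _ hm.
have /goodP[d [cd ho h]] : good w (c + k.-1) (w (c + m)).
  apply: (@good_run _ (c + m)); first by have := ltn_ord m; lia.
    move=> x hx; have hxk : x - c < k by lia.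
    have := hi (Ordinal hxk); rewrite /=; congr (inner _ _); lia.
  by case/andP: (hi m).
exists c, d; split=> //; first lia.
  move=> i j; have /andP[-> _] /= := hi i.
  by have := h j; have := hm i isT => /=; lia.
by move=> j; case/andP: (h j).
Qed.

(* A rightmost witness contains no inner column: such a column would itself
   have a witness further right, with larger values. *)
Lemma good_outer_witness w c r : good w c r ->
  exists d, [/\ c < d, occ t w d,
    forall j : 'I_s, r < w (d + j) <= nth 0 lam (d + s.-1)
    & forall j : 'I_s, ~~ inner w (d + j)].
Proof.
move=> /existsP[d0 hd0].
pose P (d : 'I_(size lam)) := [&& c < d, occ t w d
  & [forall j : 'I_s, r < w (d + j) <= nth 0 lam (d + s.-1)]].
have [d /and3P[cd ho /forallP h] hmax] := @arg_maxnP _ d0 P val hd0.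
exists d; split=> // j; apply/negP => /andP[_ /existsP[d' /and3P[hd' ho' /forallP h']]].
have : d' <= d.
  apply: hmax; rewrite /P ho' /=; apply/andP; split; first lia.
  by apply/forallP => j'; have := h' j'; have := h j; lia.
lia.
Qed.

Section Invariance.
Variables w w' : nat -> nat.
Hypothesis outer : forall c, ~~ inner w c -> w' c = w c.
Hypothesis innerw : forall c, inner w c -> (0 < w' c) && good w c (w' c).

(** A witness free of inner columns is common to [w] and [w']. *)
Lemma good_sub c r : good w c r -> good w' c r.
Proof.
move=> /good_outer_witness[d [cd ho h hi]]; apply/goodP; exists d; split=> //.
  by rewrite (eq_occ t (w' := w) (d' := d)) // => j; apply: outer.
by move=> j; rewrite outer.
Qed.

Lemma inner_sub c : inner w c -> inner w' c.
Proof. by case/innerw/andP => h /good_sub h'; rewrite /inner h. Qed.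

Lemma good_invariant c r : good w' c r = good w c r.
Proof.
apply/idP/idP; last exact: good_sub.
case/good_outer_witness => d [cd ho h hi]; apply/goodP.
(* The witness avoids the inner columns of [w'], hence by [inner_sub] those of [w], where alone the
   two words may differ. *)
have e (j : 'I_s) : w' (d + j) = w (d + j).
  by apply: outer; apply: contra (hi j); apply: inner_sub.
exists d; split=> //.
  by rewrite (eq_occ t (w' := w') (d' := d)).
by move=> j; rewrite -e.
Qed.

Lemma inner_invariant c : inner w' c = inner w c.
Proof.
apply/idP/idP; last exact: inner_sub.
(* A column outer for [w] has the same entry in both words, so goodness above that entry decides
   both cases alike. *)
move=> h; apply/negPn/negP => hn.
by move: h hn; rewrite /inner good_invariant => h /[dup] /outer e; rewrite -e h.
Qed.

End Invariance.
End Inner.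

(** * Maximal runs of a set of columns, and maps acting run by run *)

Section Runs.
Variables (I : pred nat) (N : nat).
Hypothesis I_lt : forall c, I c -> c < N.

Fixpoint run_start c :=
  if c is c'.+1 then if I c' then run_start c' else c else c.

(** The end is exclusive. If no column outside [I] is found before [N], [find] returns the length of
    the list and, for [c <= N], the end is [N]. *)
Definition run_end c := c + find (predC I) (iota c (N - c)).

Lemma run_start_le c : run_start c <= c.
Proof. by elim: c => //= c IH; case: ifP => // _; apply: leqW. Qed.

Lemma run_start_in c x : run_start c <= x < c -> I x.
Proof.
elim: c => [|c IH] /=; first lia.
case: ifP => [Ic|_]; last lia.
case: (eqVneq x c) => [-> //|nx] hx; apply: IH; lia.
Qed.

Lemma run_start_eq c c' : c <= c' -> (forall x, c <= x < c' -> I x) ->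
  run_start c' = run_start c.
Proof.
elim: c' => [|c' IH] hc h; first by move: hc; rewrite leqn0 => /eqP ->.
move: hc; rewrite leq_eqVlt => /predU1P[-> //|hc] /=.
by rewrite h; [apply: IH => // x hx; apply: h|]; lia.
Qed.

Lemma run_endS c : I c -> run_end c = run_end c.+1.
Proof.
move=> Ic; rewrite /run_end; have := I_lt Ic => cN.
by rewrite (_ : N - c = (N - c.+1).+1) /= ?Ic /=; lia.
Qed.

Lemma run_end_ge c : c <= run_end c.
Proof. exact: leq_addr. Qed.

Lemma run_end_gt c : I c -> c < run_end c.
Proof. by move/run_endS ->; apply: run_end_ge. Qed.

Lemma run_end_in c x : c <= x < run_end c -> I x.
Proof.
case/andP => cx xe.
have hx : x - c < find (predC I) (iota c (N - c)).
  by move: xe; rewrite /run_end; lia.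
have := before_find 0 hx; rewrite nth_iota ?subnKC //=.
  by move/negbFE.
by apply: leq_trans hx _; rewrite -{2}(size_iota c (N - c)) find_size.
Qed.

Lemma run_end_eq c c' : c <= c' -> (forall x, c <= x < c' -> I x) ->
  run_end c' = run_end c.
Proof.
elim: c' => [|c' IH] hc h; first by move: hc; rewrite leqn0 => /eqP ->.
move: hc; rewrite leq_eqVlt => /predU1P[-> //|hc].
have Ic' : I c' by apply: h; lia.
by rewrite -run_endS //; apply: IH => // x hx; apply: h; lia.
Qed.

Lemma same_run c x : I c -> run_start c <= x < run_end c ->
  [/\ I x, run_start x = run_start c & run_end x = run_end c].
Proof.
move=> Ic hx; case: (leqP c x) => cx.
  have h y : c <= y <= x -> I y.
    by move=> hy; apply: (@run_end_in c); lia.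
  split; first by apply: h; lia.
    by apply: run_start_eq => // y hy; apply: h; lia.
  by apply: run_end_eq => // y hy; apply: h; lia.
have h y : x <= y < c -> I y.
  by move=> hy; apply: (@run_start_in c); lia.
split; first by apply: h; lia.
  by rewrite (@run_start_eq x c) //; lia.
by rewrite (@run_end_eq x c) //; lia.
Qed.

Definition segment (w : nat -> nat) l r := [seq w i | i <- index_iota l r].

Lemma size_segment w l r : size (segment w l r) = r - l.
Proof. by rewrite size_map size_iota. Qed.

Lemma nth_segment w l r i : i < r - l -> nth 0 (segment w l r) i = w (l + i).
Proof. by move=> h; rewrite (nth_map 0) ?size_iota // nth_iota. Qed.

Lemma mem_segment w l r x : l <= x < r -> w x \in segment w l r.
Proof. by move=> h; apply: map_f; rewrite mem_index_iota. Qed.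

Definition run_word w c := segment w (run_start c) (run_end c).

Variable F : seq nat -> seq nat.
Hypothesis perm_F : forall x, perm_eq (F x) x.

Definition map_runs w c :=
  if I c then nth 0 (F (run_word w c)) (c - run_start c) else w c.

(** All columns of a run share its two ends, so the columnwise definition reads off one and the same
    sequence, of unchanged length. *)
Lemma run_word_map_runs w c : I c -> run_word (map_runs w) c = F (run_word w c).
Proof.
move=> Ic; apply: (@eq_from_nth _ 0).
  by rewrite (perm_size (perm_F _)) !size_segment.
move=> i; rewrite size_segment => hi; rewrite nth_segment //.
have [Ii si ei] := @same_run c (run_start c + i) Ic ltac:(lia).
by rewrite /map_runs /run_word Ii si ei addKn.
Qed.

Lemma map_runs_source w c : I c -> exists c',
  [/\ I c', run_start c <= c' < run_end c & map_runs w c = w c'].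
Proof.
move=> Ic; have hc := run_end_gt Ic; have hs := run_start_le c.
have : map_runs w c \in run_word (map_runs w) c by apply: mem_segment; lia.
rewrite run_word_map_runs // (perm_mem (perm_F _)) => /mapP[c'].
rewrite mem_index_iota => hc' e; exists c'; split=> //.
by have [] := same_run Ic hc'.
Qed.

Lemma map_runs_target w c : exists c', map_runs w c' = w c.
Proof.
case: (boolP (I c)) => Ic; last by exists c; rewrite /map_runs (negbTE Ic).
have hc := run_end_gt Ic; have hs := run_start_le c.
have : w c \in run_word w c by apply: mem_segment; lia.
by rewrite -(perm_mem (perm_F _)) -run_word_map_runs // => /mapP[c' _ ->]; exists c'.
Qed.

(** Serves to preserve the empty rows: a row is nonempty exactly when its code is a value of the
    word. *)
Lemma map_runs_values w r :
  (exists c, map_runs w c = r) <-> (exists c, w c = r).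
Proof.
split=> -[c <-]; last exact: map_runs_target.
case: (boolP (I c)) => Ic; last by exists c; rewrite /map_runs (negbTE Ic).
by have [c' [_ _ ->]] := map_runs_source w Ic; exists c'.
Qed.

(** At most one 1 per row; the code 0 of an empty column may repeat. *)
Definition pos_inj (w : nat -> nat) :=
  forall c c', 0 < w c -> w c = w c' -> c = c'.

Lemma uniq_run_word w c : pos_inj w -> (forall c, I c -> 0 < w c) -> I c ->
  uniq (run_word w c).
Proof.
move=> wi wp Ic; rewrite map_inj_in_uniq ?iota_uniq // => x y.
rewrite !mem_index_iota => hx _; apply: wi; apply: wp.
by case: (same_run Ic hx).
Qed.

(** Each new entry is an old entry of the same run. Equal new entries thus have the same source,
    hence the same run, and within a run [F] yields distinct entries. *)
Lemma map_runs_pos_inj w : pos_inj w -> (forall c, I c -> 0 < w c) ->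
  pos_inj (map_runs w).
Proof.
move=> wi wp c1 c2.
case: (boolP (I c1)) => I1; last first.
  rewrite {1 2}/map_runs (negbTE I1) => w1.
  case: (boolP (I c2)) => I2; last by rewrite /map_runs (negbTE I2); apply: wi.
  have [c' [Ic' _ ->]] := map_runs_source w I2.
  by move/(wi _ _ w1) => e; rewrite -e (negbTE I1) in Ic'.
have [c1' [I1' h1 e1]] := map_runs_source w I1; rewrite e1 => w1.
case: (boolP (I c2)) => I2; last first.
  by rewrite /map_runs (negbTE I2) => /(wi _ _ w1) e; rewrite -e I1' in I2.
have [c2' [I2' h2 e2]] := map_runs_source w I2; rewrite e2 => /(wi _ _ w1) e.
have [_ s1 r1] := same_run I1 h1; have [_ s2 r2] := same_run I2 h2.
have es : run_start c1 = run_start c2 by rewrite -s1 -s2 e.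
have er : run_end c1 = run_end c2 by rewrite -r1 -r2 e.
have : map_runs w c1 = map_runs w c2 by rewrite e1 e2 e.
rewrite /map_runs I1 I2 /run_word es er -/(run_word w c2) => /eqP.
have k1 := run_end_gt I1; have k2 := run_end_gt I2.
have l1 := run_start_le c1; have l2 := run_start_le c2.
rewrite nth_uniq ?(perm_size (perm_F _)) ?size_segment ?(perm_uniq (perm_F _)) //;
  rewrite ?uniq_run_word //; lia.
Qed.

End Runs.

(** * The rearrangement of all runs of inner columns *)

Section Swap.
Variables (lam : seq nat) (s : nat) (t : 'S_s).
Hypothesis s0 : 0 < s.
Variables (k l : nat) (p : vpattern k) (q : vpattern l).

Local Notation innerw w := (inner lam t w).
Local Notation run w := (run_word (innerw w) (size lam) w).

Definition swap w := map_runs (innerw w) (size lam) (rearrange p q) w.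

Let inner_lt w c : innerw w c -> c < size lam.
Proof. exact: inner_lt_size. Qed.

Lemma swap_outer w c : ~~ innerw w c -> swap w c = w c.
Proof. by rewrite /swap /map_runs => /negbTE ->. Qed.

(** The new entry at [c] comes from a column [c'] of the same run. Goodness above it passes to [c]
    directly if [c <= c'], and along the run otherwise. *)
Lemma swap_inner w c : innerw w c ->
  (0 < swap w c) && good lam t w c (swap w c).
Proof.
move=> Ic.
rewrite /swap.
have [c' [Ic' hc' ->]] := map_runs_source (@inner_lt w) (perm_rearrange p q) w Ic.
have /andP[-> g] := Ic'; case: (leqP c c') => cc /=.
  exact: good_anti g.
apply: (good_run s0 (ltnW cc)) g => x hx.
have hc := run_end_gt (@inner_lt w) Ic.
by case: (same_run (@inner_lt w) (x := x) Ic); lia.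
Qed.

Lemma inner_swap w : innerw (swap w) =1 innerw w.
Proof. move=> c; exact: inner_invariant (@swap_outer w) (@swap_inner w) c. Qed.

Lemma swap_eq0 w c : (swap w c == 0) = (w c == 0).
Proof.
case: (boolP (innerw w c)) => Ic; last by rewrite swap_outer.
by have /andP[h _] := swap_inner Ic; have /andP[h' _] := Ic; rewrite !eqn0Ngt h h'.
Qed.

Lemma swap_values w r : (exists c, swap w c = r) <-> (exists c, w c = r).
Proof. exact: (map_runs_values (@inner_lt w) (perm_rearrange p q)). Qed.

Lemma swap_pos_inj w : pos_inj w -> pos_inj (swap w).
Proof.
move=> wi; apply: (map_runs_pos_inj (@inner_lt w) (perm_rearrange p q)) => //.
by move=> c /andP[].
Qed.

(** A new entry in an inner column lies below a witness that fits under a column further right, and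
    heights decrease weakly to the right. *)
Lemma swap_bounded w : sorted geq lam -> (forall c, w c <= nth 0 lam c) ->
  forall c, swap w c <= nth 0 lam c.
Proof.
move=> lam_sorted wb c; case: (boolP (innerw w c)) => Ic; last by rewrite swap_outer.
have /andP[_ /(goodP _ _ s0 _ _ _)[d [cd _ h]]] := swap_inner Ic.
have /andP[h1 h2] := h (Ordinal s0).
have hd : d + s.-1 < size lam.
  rewrite ltnNge; apply/negP => hd; move: h2; rewrite [X in _ <= X]nth_default //; lia.
have : nth 0 lam (d + s.-1) <= nth 0 lam c.
  have tr : transitive geq by move=> x y z /= a b; apply: leq_trans b a.
  by apply: (sorted_leq_nth tr (leqnn) 0 lam_sorted) => //=; rewrite ?inE; lia.
lia.
Qed.

(** An interval of inner columns lies in a single maximal run, and every interval within a run is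
    inner. *)
Lemma word_contains_runs n (v : vpattern n) w : 0 < n ->
  word_contains lam t (vperm v) w <->
  exists2 c, innerw w c & seq_contains (vperm v) (run w c).
Proof.
move=> n0; split=> [/(word_containsP _ _ s0 _ _ n0)[c oc ic]|[c Ic [d dn od]]].
  have Ic : innerw w c by have := ic (Ordinal n0); rewrite addn0.
  have ls := run_start_le (innerw w) c.
  have lt (i : 'I_n) : c + i < run_end (innerw w) (size lam) c.
    rewrite -(@run_end_eq _ _ (@inner_lt w) c (c + i)) ?leq_addr //.
      by apply: run_end_gt => //; apply: inner_lt.
    move=> x hx; have hxn : x - c < n by have := ltn_ord i; lia.
    by have := ic (Ordinal hxn); rewrite /= subnKC //; case/andP: hx.
  exists c => //; exists (c - run_start (innerw w) c).
    have hn : n.-1 < n by lia.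
    by have := lt (Ordinal hn); rewrite size_segment /=; lia.
  rewrite (eq_occ _ (w' := w) (d' := c)) // => i.
  by rewrite nth_segment; [congr w|have := lt i]; lia.
rewrite size_segment in dn.
apply/(word_containsP _ _ s0 _ _ n0); exists (run_start (innerw w) c + d).
  rewrite (eq_occ _ (w' := nth 0 (run w c)) (d' := d)) // => i.
  have di : d + i < run_end (innerw w) (size lam) c - run_start (innerw w) c.
    by apply: leq_trans dn; rewrite ltn_add2l.
  by rewrite -addnA nth_segment.
move=> i; case: (same_run (@inner_lt w) (x := run_start (innerw w) c + d + i) Ic) => //.
have := ltn_ord i; lia.
Qed.

Lemma uniq_run w c : pos_inj w -> innerw w c -> uniq (run w c).
Proof.
move=> wi Ic; apply: uniq_run_word => //; first exact: inner_lt.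
by move=> x /andP[].
Qed.

Lemma eq_run_word I I' N w c : I =1 I' -> run_word I N w c = run_word I' N w c.
Proof.
move=> e; rewrite /run_word /run_end (eq_find (a2 := predC I')); last first.
  by move=> x /=; rewrite e.
by congr (segment _ _ _); elim: c => //= c ->; rewrite e.
Qed.

Lemma run_swap w c : innerw w c -> run (swap w) c = rearrange p q (run w c).
Proof.
move=> Ic; rewrite (eq_run_word _ _ _ (inner_swap w)).
exact: (run_word_map_runs (@inner_lt w) (perm_rearrange p q)).
Qed.

Section SwapWilf.
Hypotheses (k0 : 0 < k) (cp : consecutive p) (pq : Wilf_equiv p q).

Lemma swap_avoids w : 0 < l -> consecutive q -> pos_inj w ->
  ~ word_contains lam t (vperm p) w ->
  ~ word_contains lam t (vperm q) (swap w).
Proof.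
move=> l0 cq wi hp /(word_contains_runs _ _ l0)[c]; rewrite inner_swap => Ic.
rewrite run_swap //; apply: rearrange_avoids => //; first exact: uniq_run.
by move=> h; apply: hp; apply/(word_contains_runs _ _ k0); exists c.
Qed.

Lemma swap_inj w w' : pos_inj w -> pos_inj w' ->
  ~ word_contains lam t (vperm p) w -> ~ word_contains lam t (vperm p) w' ->
  swap w =1 swap w' -> w =1 w'.
Proof.
move=> wi wi' hp hp' e c.
(* The inner columns can be read off the swapped word. Here [inner_invariant] acts as
   extensionality, applied to the two pointwise equal swapped words. *)
have eI : innerw w =1 innerw w'.
  move=> x; rewrite -inner_swap -[in RHS]inner_swap.
  by symmetry; apply: (inner_invariant s0) => y; rewrite -e // => /andP[-> ->].
case: (boolP (innerw w c)) => Ic; last first.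
  by have := e c; rewrite !swap_outer -?eI.
have Ic' : innerw w' c by rewrite -eI.
have er : run w c = run w' c.
  apply: (rearrange_inj k0 cp pq); rewrite ?uniq_run //.
  - by move=> h; apply: hp; apply/(word_contains_runs _ _ k0); exists c.
  - by move=> h; apply: hp'; apply/(word_contains_runs _ _ k0); exists c.
  rewrite -!run_swap // (eq_run_word _ _ _ (inner_swap w)).
  rewrite [RHS](eq_run_word _ _ _ (inner_swap w')) -(eq_run_word _ _ _ eI).
  by apply: eq_map.
have hs := run_start_le (innerw w) c.
have he := run_end_gt (@inner_lt w) Ic.
have := congr1 (nth 0 ^~ (c - run_start (innerw w) c)) er.
rewrite -(eq_run_word _ _ _ eI) !nth_segment ?subnKC //; lia.
Qed.

End SwapWilf.
End Swap.

(** * Fillings coded as words, and the comparison of cardinalities *)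

Section Fillings.
Variable lam : seq nat.
Hypothesis lam_sorted : sorted geq lam.

Local Notation filling := {set 'I_(width lam) * 'I_(height lam)}.
Implicit Types (A : filling) (w : nat -> nat).

(** Totalized over [nat]: positions beyond the board get 0, like empty columns. *)
Definition word_of A (c : nat) : nat :=
  if insub c is Some c' then
    if filling_word A c' is Some r then (val r).+1 else 0
  else 0.

Definition filling_of w : filling :=
  [set x : 'I_(width lam) * 'I_(height lam) | w x.1 == x.2.+1].

Lemma filling_column_unique A c r r' :
  is_filling A -> (c, r) \in A -> (c, r') \in A -> r = r'.
Proof.
case/and3P => _ /forallP/(_ c)/card_le1_eqP h _ hr hr'.
by apply: h; rewrite inE.
Qed.

Lemma filling_row_unique A c c' r :
  is_filling A -> (c, r) \in A -> (c', r) \in A -> c = c'.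
Proof.
case/and3P => _ _ /forallP/(_ r)/card_le1_eqP h hr hr'.
by apply: h; rewrite inE.
Qed.

Lemma filling_wordE A c r :
  is_filling A -> (filling_word A c == Some r) = ((c, r) \in A).
Proof.
move=> fA; rewrite /filling_word; case: pickP => [r' hr'|h]; last by rewrite h.
apply/eqP/idP => [[<-]//|hr]; by rewrite (filling_column_unique fA hr hr').
Qed.

Lemma word_of_ord A (c : 'I_(width lam)) :
  word_of A c = if filling_word A c is Some r then (val r).+1 else 0.
Proof. by rewrite /word_of valK. Qed.

Lemma word_ofE A (c : 'I_(width lam)) (r : 'I_(height lam)) :
  is_filling A -> (word_of A c == r.+1) = ((c, r) \in A).
Proof.
move=> fA; rewrite -filling_wordE // word_of_ord.
by case: (filling_word A c).
Qed.

Lemma word_of_pos A c : is_filling A -> 0 < word_of A c ->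
  exists (c' : 'I_(width lam)) (r : 'I_(height lam)),
    [/\ c = c', word_of A c = r.+1 & (c', r) \in A].
Proof.
move=> fA; rewrite {1 2}/word_of; case: insubP => // c' _ <-.
case e: (filling_word A c') => [r|] // _; exists c', r; split=> //.
by rewrite -filling_wordE // e.
Qed.

Lemma word_of_pos_inj A : is_filling A -> pos_inj (word_of A).
Proof.
move=> fA c c' w0 e.
have [x [r [ec er xr]]] := word_of_pos fA w0.
rewrite e in w0; have [x' [r' [ec' er' xr']]] := word_of_pos fA w0.
have rr : r = r' by apply: val_inj; move: er; rewrite e er' => -[].
by rewrite ec ec'; rewrite -rr in xr'; rewrite (filling_row_unique fA xr xr').
Qed.

Lemma word_of_bounded A c : is_filling A -> word_of A c <= nth 0 lam c.
Proof.
move=> fA; case: (posnP (word_of A c)) => [->//|w0].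
have [x [r [-> -> xr]]] := word_of_pos fA w0.
by have /and3P[/'forall_implyP/(_ _ xr)] := fA.
Qed.

Lemma word_ofK A : is_filling A -> filling_of (word_of A) = A.
Proof. by move=> fA; apply/setP => -[c r]; rewrite inE word_ofE. Qed.

Lemma filling_of_is_filling w : pos_inj w -> (forall c, w c <= nth 0 lam c) ->
  is_filling (filling_of w).
Proof.
move=> wi wb; apply/and3P; split.
- apply/'forall_implyP => -[c r]; rewrite inE /= => /eqP e.
  by rewrite /in_board -e.
- apply/forallP => c; apply/card_le1_eqP => r r'.
  by rewrite !inE /= => /eqP -> /eqP[/val_inj].
apply/forallP => r; apply/card_le1_eqP => c c'.
rewrite !inE /= => /eqP e /eqP e'.
by apply/val_inj/wi; rewrite ?e ?e'.
Qed.

Lemma nth_le_height c : nth 0 lam c <= height lam.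
Proof.
rewrite /height -nth0; case: (ltnP c (size lam)) => hc; last by rewrite nth_default.
have tr : transitive geq by move=> x y z /= a b; apply: leq_trans b a.
by apply: (sorted_leq_nth tr (leqnn) 0 lam_sorted) => //=; rewrite ?inE; lia.
Qed.

Lemma filling_ofK w : pos_inj w -> (forall c, w c <= nth 0 lam c) ->
  word_of (filling_of w) =1 w.
Proof.
move=> wi wb c; have fA := filling_of_is_filling wi wb.
case: (ltnP c (width lam)) => hc; last first.
  rewrite /word_of insubF; last by rewrite ltnNge hc.
  (* Beyond the board the bound itself is 0, so [w c] vanishes too. *)
  by have := wb c; rewrite nth_default //; lia.
case: (posnP (w c)) => w0.
  case: (posnP (word_of (filling_of w) c)) => [->|/(word_of_pos fA)].
    by rewrite w0.
  by case=> c' [r [ec _]]; rewrite inE /= -ec w0.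
have hr : (w c).-1 < height lam.
  by have := wb c; have := nth_le_height c; lia.
have : (Ordinal hc, Ordinal hr) \in filling_of w by rewrite inE /= prednK.
by rewrite -word_ofE //= prednK // => /eqP.
Qed.

Lemma empty_columnsE A :
  is_filling A -> empty_columns A = [set c : 'I__ | word_of A c == 0].
Proof.
move=> fA; apply/setP => c; rewrite !inE word_of_ord /filling_word.
case: pickP => [r hr|h] /=; apply/forallP; last by move=> r; rewrite h.
by move/(_ r); rewrite hr.
Qed.

Lemma in_empty_rows A (r : 'I_(height lam)) : is_filling A ->
  r \notin empty_rows A <-> exists c, word_of A c = r.+1.
Proof.
move=> fA; rewrite inE negb_forall; split.
  by case/existsP => c; rewrite negbK -word_ofE // => /eqP; exists c.
case=> c e; have w0 : 0 < word_of A c by rewrite e.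
have [c' [r' [_ er hr]]] := word_of_pos fA w0.
apply/existsP; exists c'; rewrite negbK (_ : r = r') //.
by apply: val_inj; move: er; rewrite e => -[].
Qed.

Lemma vperm_dsum_lshift k l (p : vpattern k) (q : vpattern l) i :
  vperm (dsum p q) (lshift l i) = lshift l (vperm p i).
Proof.
rewrite permE /dsum_fun; case: split_ordP => j /eqP; rewrite ?eq_lshift ?eq_lrshift //.
by move/eqP ->.
Qed.

Lemma vperm_dsum_rshift k l (p : vpattern k) (q : vpattern l) j :
  vperm (dsum p q) (rshift k j) = rshift k (vperm q j).
Proof.
rewrite permE /dsum_fun; case: split_ordP => i /eqP; rewrite ?eq_rshift ?eq_rlshift //.
by move/eqP ->.
Qed.

Lemma filling_containsE k l (p : vpattern k) (q : vpattern l) A :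
  0 < k -> 0 < l -> consecutive p -> consecutive q -> is_filling A ->
  filling_contains A (dsum p q) <->
  word_contains lam (vperm q) (vperm p) (word_of A).
Proof.
move=> k0 l0 cp cq fA; have ll : l.-1 < l by lia.
split.
  case/existsP => f /existsP[g /and4P[/forallP hfg /'forall_forallP hg hf]].
  move/'forall_implyP => hb.
  have [c [d [cd hc hd]]] := (vpositions_dsum f k0 l0 cp cq).1 hf.
  have hw x : word_of A (f x) = (g x).+1.
    by apply/eqP; rewrite word_ofE // -filling_wordE.
  exists c, d; split=> //.
  - apply/occP => i j; rewrite -!hc !hw ltnS (eqP (hg _ _)).
    by rewrite !vperm_dsum_lshift.
  - apply/occP => i j; rewrite -!hd !hw ltnS (eqP (hg _ _)).
    by rewrite !vperm_dsum_rshift ltn_add2l.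
  - move=> i j; rewrite -hc -hd !hw !ltnS (eqP (hg _ _)).
    rewrite vperm_dsum_lshift vperm_dsum_rshift /=.
    by have := ltn_ord (vperm p i); lia.
  move=> j; rewrite -hd hw.
  (* The board condition at the last position bounds the maximum, hence every entry of the second
     block. *)
  have := hb (rshift k (Ordinal ll)); rewrite /= -addnS prednK // eqxx hd.
  by move/(_ isT); apply: leq_ltn_trans; exact: (leq_bigmax (rshift k j)).
case=> c [d [cd /occP hp /occP hq h hb]].
pose pos (x : 'I_(k + l)) := match split x with inl i => c + i | inr j => d + j end.
have posl i : pos (lshift l i) = c + i.
  rewrite /pos; case: split_ordP => j /eqP; rewrite ?eq_lshift ?eq_lrshift //.
  by move/eqP ->.
have posr i : pos (rshift k i) = d + i.
  rewrite /pos; case: split_ordP => j /eqP; rewrite ?eq_rshift ?eq_rlshift //.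
  by move/eqP ->.
have hpos x : 0 < word_of A (pos x).
  case: (split_ordP x) => i ->; rewrite ?posl ?posr.
    by have /andP[] := h i (Ordinal l0).
  by have := h (Ordinal k0) i; lia.
have hW x : pos x < width lam.
  by have [c' [r [-> _ _]]] := word_of_pos fA (hpos x).
have hH x : (word_of A (pos x)).-1 < height lam.
  by have [c' [r [_ -> _]]] := word_of_pos fA (hpos x); apply: ltn_ord.
apply/existsP; exists [ffun x => Ordinal (hW x)].
apply/existsP; exists [ffun x => Ordinal (hH x)].
apply/and4P; split.
- apply/forallP => x; rewrite !ffunE filling_wordE // -word_ofE //=.
  by rewrite prednK.
- apply/'forall_forallP => x y; rewrite !ffunE /= -ltnS !prednK //.
  case: (split_ordP x) => i ->; case: (split_ordP y) => j ->;
    rewrite ?posl ?posr ?vperm_dsum_lshift ?vperm_dsum_rshift ?hp ?hq //=.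
  + have /andP[_ ->] := h i j; apply/eqP; have := ltn_ord (vperm p i); lia.
  + have /andP[_ h'] := h j i; have := ltn_ord (vperm p j); lia.
  by rewrite ltn_add2l.
- apply/(vpositions_dsum _ k0 l0 cp cq); exists c, d; split=> //.
    by move=> i; rewrite ffunE /= posl.
  by move=> i; rewrite ffunE /= posr.
apply/'forall_implyP => x /eqP ex; rewrite ffunE /in_board /=.
have -> : pos x = d + l.-1.
  rewrite (_ : x = rshift k (Ordinal ll)) ?posr //; apply: val_inj => /=; lia.
have hb0 := hb (Ordinal l0); have h0 := h (Ordinal k0) (Ordinal l0).
(* First-block entries lie below second-block ones, so the column height bounds all codes; the
   predecessor turns codes back into rows. *)
have : \max_b ([ffun x => Ordinal (hH x)] b : 'I_(height lam))
       <= (nth 0 lam (d + l.-1)).-1.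
  apply/bigmax_leqP => y _; rewrite ffunE /=.
  case: (split_ordP y) => i ->; rewrite ?posl ?posr.
    by have := h i (Ordinal l0); lia.
  by have := hb i; lia.
by move/leq_ltn_trans; apply; lia.
Qed.

Lemma card_avoiding_fillings_le k l s (p : vpattern k) (q : vpattern l)
    (t : vpattern s) (C : {set 'I_(width lam)}) (R : {set 'I_(height lam)}) :
  0 < k -> 0 < l -> 0 < s ->
  consecutive p -> consecutive q -> consecutive t -> Wilf_equiv p q ->
  #|avoiding_fillings C R (dsum p t)| <= #|avoiding_fillings C R (dsum q t)|.
Proof.
move=> k0 l0 s0 cp cq ct pq.
pose sw A := swap lam (vperm t) p q (word_of A).
have swi A : is_filling A -> pos_inj (sw A).
  by move=> fA; apply: swap_pos_inj => //; apply: word_of_pos_inj.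
have swb A : is_filling A -> forall c, sw A c <= nth 0 lam c.
  by move=> fA; apply: swap_bounded => // c; apply: word_of_bounded.
have avoidP n (v : vpattern n) A : 0 < n -> consecutive v -> is_filling A ->
    ~~ filling_contains A (dsum v t) ->
    ~ word_contains lam (vperm t) (vperm v) (word_of A).
  by move=> n0 cv fA /negP hA hw; apply: hA; apply/filling_containsE.
have inj : {in avoiding_fillings C R (dsum p t) &,
            injective (fun A => filling_of (sw A))}.
  move=> A B; rewrite !inE => /and4P[fA _ _ hA] /and4P[fB _ _ hB] e.
  rewrite -(word_ofK fA) -(word_ofK fB); apply/setP => x; rewrite !inE.
  suff /(_ x.1) -> : word_of A =1 word_of B by [].
  apply: (swap_inj s0 k0 cp pq); try exact: word_of_pos_inj.
  - exact: avoidP.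
  - exact: avoidP.
  move=> c; rewrite -/(sw A) -/(sw B).
  by rewrite -(filling_ofK (swi _ fA) (swb _ fA)) -(filling_ofK (swi _ fB) (swb _ fB)) e.
rewrite -(card_in_imset inj); apply/subset_leq_card/subsetP => _ /imsetP[A + ->].
rewrite !inE => /and4P[fA /eqP hC /eqP hR hA].
have fB := filling_of_is_filling (swi _ fA) (swb _ fA).
have eB := filling_ofK (swi _ fA) (swb _ fA).
apply/and4P; split=> //.
- rewrite -hC !empty_columnsE //; apply/eqP/setP => c.
  by rewrite !inE eB swap_eq0.
(* Nonempty rows are compared instead, as these are the values of the word. *)
- rewrite -hR; apply/eqP/setP => r; apply: negb_inj; apply/idP/idP.
    move/(in_empty_rows _ fB) => [c]; rewrite eB => e.
    by apply/(in_empty_rows _ fA); apply/(swap_values lam (vperm t) p q); exists c.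
  move/(in_empty_rows _ fA)/(swap_values lam (vperm t) p q) => [c e].
  by apply/(in_empty_rows _ fB); exists c; rewrite eB.
apply/negP => /(filling_containsE l0 s0 cq ct fB).
case=> c [d [cd hp hq h hb]].
apply: (swap_avoids s0 k0 cp pq l0 cq (word_of_pos_inj fA) (avoidP _ _ _ k0 cp fA hA)).
(* The decoded filling gives back [sw A] only pointwise, so the occurrence is carried over condition
   by condition. *)
exists c, d; split=> //.
- by rewrite (eq_occ _ (w' := word_of (filling_of (sw A))) (d' := c)).
- by rewrite (eq_occ _ (w' := word_of (filling_of (sw A))) (d' := d)).
- by move=> i j; have := h i j; rewrite !eB.
by move=> j; have := hb j; rewrite eB.
Qed.

End Fillings.

Theorem theorem3p4 (a b s : nat)
    (alpha : vpattern a) (beta : vpattern b) (sigma : vpattern s)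
    (ha : 0 < a) (hb : 0 < b) (hs : 0 < s)
    (calpha : consecutive alpha) (cbeta : consecutive beta)
    (csigma : consecutive sigma)
    (hW : Wilf_equiv alpha beta) :
  filling_shape_Wilf_equiv (dsum alpha sigma) (dsum beta sigma).
Proof.
move=> lam /andP[lam_sorted _] C R; apply/eqP; rewrite eqn_leq.
(* The second inequality exchanges [alpha] and [beta], with the Wilf equivalence reversed. *)
by rewrite !card_avoiding_fillings_le // => n; rewrite hW.
Qed.
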